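(* Let $A$, $\Omega=\bigcup_{i=1}^m\Omega_i$, $\mathcal{E}$, $W$, $M$, $B$, $\widehat{A}$ be as defined in the context, and assume that $A$ and $-W$ are symmetric positive definite. Let $\Lambda\subset\mathbb{R}^{\mathcal{E}}$ be a subspace with $\dim(\Lambda)=r$, let $Z\in\mathbb{R}^{|\mathcal{E}|\times r}$ satisfy $\mathrm{range}(Z)=\Lambda$, and let $$Q:=\begin{pmatrix}\frac14\widehat{A} & M^TWZ\\ Z^TWM & -Z^TWZ\end{pmatrix},$$ acting on vectors $(p,\eta)\in\mathbb{R}^\Omega\times\mathbb{R}^r$. Then the Schur complement $S_\eta$ of $Q$ obtained after eliminating $p$ is positive definite, and it is given by $$S_\eta=Z^TS_\lambda Z,\qquad S_\lambda=-\bigl(W+4WM\widehat{A}^{-1}M^TW\bigr)=-\bigl(W+WM\widehat{A}^{-1}B\bigr).$$ Consequently, $S_\lambda$ is positive definite on $\Lambda=\mathrm{range}(Z)$, i.e. $\mu^TS_\lambda\mu>0$ for all $0\neq\mu\in\Lambda$.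
   Context: Let $A=(a_{kl})\in\mathbb{R}^{N\times N}$ be a symmetric matrix, with rows and columns indexed by $\Omega=\{1,\dots,N\}$. Let $\Omega=\bigcup_{i=1}^m\Omega_i$ be a partition into $m$ pairwise disjoint subsets (subdomains), with the indices ordered so that those of $\Omega_1,\Omega_2,\dots,\Omega_m$ are consecutive. $A_{ij}$ denotes the submatrix of $A$ with rows in $\Omega_i$ and columns in $\Omega_j$; for $i\ne j$ write $i\sim j$ if $A_{ij}\neq0$. For finite sets $X,Y$, $\mathbb{R}^X$ denotes real vectors indexed by $X$ and $\mathbb{R}^{X\times Y}$ real matrices with rows indexed by $X$ and columns by $Y$. Interface edges: $\mathcal{E}$ is the set of pairs $(k,l)$ with $k\in\Omega_i$, $l\in\Omega_j$ for some $i<j$ and $a_{kl}\ne0$. $W\in\mathbb{R}^{\mathcal{E}\times\mathcal{E}}$ is the diagonal matrix with entry $a_{kl}$ at $e=(k,l)\in\mathcal{E}$. The averaging matrix $M\in\mathbb{R}^{\mathcal{E}\times\Omega}$ is given by $(Mp)_e=\frac{p_k+p_l}{2}$ for $e=(k,l)\in\mathcal{E}$, $p\in\mathbb{R}^\Omega$. The coupling matrix $B\in\mathbb{R}^{\Omega\times\mathcal{E}}$ has, for $q\in\Omega$ and $e=(k,l)\in\mathcal{E}$, the entry $[B]_{q,e}=2a_{kl}$ if $q\in\{k,l\}$ and $[B]_{q,e}=0$ otherwise. For $i\sim j$ let $D_{ij}=\mathrm{diag}(A_{ij}\mathbf{1}_{\Omega_j})$ (diagonal matrix indexed by $\Omega_i$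 whose $k$-th diagonal entry is $\sum_{l\in\Omega_j}a_{kl}$), let $A_i=A_{ii}-\sum_{j:\,j\sim i}D_{ij}$, and let $\widehat{A}=\mathrm{diag}(A_1,\dots,A_m)\in\mathbb{R}^{\Omega\times\Omega}$ (block diagonal). For a block matrix $\begin{pmatrix} E & F \\ F^T & G \end{pmatrix}$ with $E$ invertible, the Schur complement obtained after eliminating the first block variable is $G-F^TE^{-1}F$. *)

(* Defs.v *)
From HB Require Import structures.
From mathcomp Require Import all_boot all_order all_algebra.

Set Implicit Arguments.
Unset Strict Implicit.
Unset Printing Implicit Defensive.

Import Order.TTheory GRing.Theory Num.Theory.
Local Open Scope ring_scope.

Section Matrices.
Variable R : realFieldType.

Definition quad n (S : 'M[R]_n) (x : 'cV[R]_n) : R := (x^T *m S *m x) 0 0.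

Definition spd n (S : 'M[R]_n) : Prop :=
  S^T = S /\ forall x : 'cV[R]_n, x != 0 -> 0 < quad S x.

Definition range p r (Z : 'M[R]_(p, r)) : {vspace 'cV[R]_p} :=
  limg (linfun (mulmx Z : 'cV[R]_r -> 'cV[R]_p)).

(* Meaningful only when the upper left block is invertible: [invmx] is the
   identity on singular matrices. *)
Definition schur n r (S : 'M[R]_(n + r)) : 'M[R]_r :=
  drsubmx S - dlsubmx S *m invmx (ulsubmx S) *m ursubmx S.

End Matrices.

(* A partition of {0, ..., N-1} into m consecutive subdomains is given by the
   sizes n_ i of the subdomains, with N = \sum_i n_ i.  As for the block
   matrices of [matrix], [tagnat.sig1 k] is the subdomain containing k, and
   [submxblock A i j] is the block A_ij. *)
Section Domain_decomposition.
Variables (R : realFieldType) (m : nat) (n_ : 'I_m -> nat).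
Local Notation N := (\sum_(i < m) n_ i)%N.
Variable A : 'M[R]_N.

Definition adj (i j : 'I_m) : bool := (i != j) && (submxblock A i j != 0).

Definition edges : {set 'I_N * 'I_N} :=
  [set kl | (tagnat.sig1 kl.1 < tagnat.sig1 kl.2)%N & A kl.1 kl.2 != 0].

(* R^edges is represented by 'cV_#|edges|, through the enumeration of edges. *)
Definition edge (e : 'I_#|edges|) : 'I_N * 'I_N := enum_val e.

Definition Wmx : 'M[R]_#|edges| := diag_mx (\row_e A (edge e).1 (edge e).2).

Definition Mmx : 'M[R]_(#|edges|, N) :=
  \matrix_(e, q) (((q == (edge e).1)%:R + (q == (edge e).2)%:R) / 2).

Lemma MmxE (p : 'cV[R]_N) e :
  (Mmx *m p) e 0 = (p (edge e).1 0 + p (edge e).2 0) / 2.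
Proof.
rewrite mxE (eq_bigr (fun q => ((q == (edge e).1)%:R * p q 0
  + (q == (edge e).2)%:R * p q 0) / 2)); last first.
  by move=> q _; rewrite mxE mulrAC mulrDl.
have sum_delta (k : 'I_N) : \sum_q (q == k)%:R * p q 0 = p k 0.
  rewrite (bigD1 k) //= eqxx mul1r [X in _ + X]big1 ?addr0 // => q /negPf->.
  by rewrite mul0r.
by rewrite -mulr_suml big_split /= !sum_delta.
Qed.

Definition Bmx : 'M[R]_(N, #|edges|) :=
  \matrix_(q, e) (if (q == (edge e).1) || (q == (edge e).2)
                  then 2 * A (edge e).1 (edge e).2 else 0).

Definition Dmx (i j : 'I_m) : 'M[R]_(n_ i) :=
  diag_mx (submxblock A i j *m (const_mx 1 : 'cV[R]_(n_ j)))^T.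

Definition Ahat : 'M[R]_N :=
  \mxdiag_(i < m) (submxblock A i i - \sum_(j < m | adj j i) Dmx i j).

End Domain_decomposition.

(* Main.v *)
(** Summing the off-diagonal entries of A edge by edge gives
    p^T A p = p^T Ahat p + sum_((k,l) edge) a_kl (p_k + p_l)^2,
    that is, Ahat = A + (2M)^T (-W) (2M).  With V = -W and C = 2M, completing
    the square shows that S_lambda = V - V C (A + C^T V C)^-1 C^T V satisfies
    mu^T S_lambda mu = (mu - C p)^T V (mu - C p) + p^T A p
    for p = (A + C^T V C)^-1 C^T V mu, so it is positive definite on the whole
    space, and Z^T S_lambda Z is positive definite because Z has full column
    rank. *)

Require Import Defs.
From HB Require Import structures.
From mathcomp Require Import all_boot all_order all_algebra.
From mathcomp Require Import ring.

Set Implicit Arguments.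
Unset Strict Implicit.
Unset Printing Implicit Defensive.

Import Order.TTheory GRing.Theory Num.Theory.
Local Open Scope ring_scope.

Section PositiveDefinite.
Variable R : realFieldType.

Lemma quadD n (S T : 'M[R]_n) x : quad (S + T) x = quad S x + quad T x.
Proof. by rewrite /quad mulmxDr mulmxDl mxE. Qed.

Lemma quad_congr n p (S : 'M[R]_n) (C : 'M[R]_(n, p)) x :
  quad (C^T *m S *m C) x = quad S (C *m x).
Proof. by rewrite /quad trmx_mul !mulmxA. Qed.

Lemma quad0 n (S : 'M[R]_n) : quad S 0 = 0.
Proof. by rewrite /quad mulmx0 mxE. Qed.

Lemma spd_quad_ge0 n (S : 'M[R]_n) x : spd S -> 0 <= quad S x.
Proof.
move=> [_ S_gt0]; have [->|/S_gt0/ltW//] := eqVneq x 0.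
by rewrite quad0.
Qed.

Lemma spd_unitmx n (S : 'M[R]_n) : spd S -> S \in unitmx.
Proof.
move=> [_ S_gt0]; rewrite -row_free_unit; apply: inj_row_free => v vS0.
apply/eqP; apply: contraT => v_neq0.
have := S_gt0 v^T; rewrite trmx_eq0 => /(_ v_neq0).
by rewrite /quad trmxK vS0 mul0mx mxE ltxx.
Qed.

(** [C] may have a kernel, so strict positivity comes from [S]. Applied to the splitting of
    [Ahat A], this makes it positive definite, hence invertible. *)
Lemma spd_add_congr n p (S : 'M[R]_n) (V : 'M[R]_p) (C : 'M[R]_(p, n)) :
  spd S -> spd V -> spd (S + C^T *m V *m C).
Proof.
move=> S_spd V_spd; have [[trS S_gt0] [trV _]] := (S_spd, V_spd); split.
  by rewrite linearD /= !trmx_mul trmxK trS trV mulmxA.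
move=> x x_neq0; rewrite quadD quad_congr ltr_wpDr ?S_gt0 //.
exact: spd_quad_ge0.
Qed.

Lemma spd_congr n p (S : 'M[R]_n) (Z : 'M[R]_(n, p)) :
    (forall x : 'cV_p, Z *m x = 0 -> x = 0) -> spd S ->
  spd (Z^T *m S *m Z).
Proof.
move=> Z_inj [trS S_gt0]; split.
  by rewrite !trmx_mul trmxK trS mulmxA.
move=> x x_neq0; rewrite quad_congr S_gt0 //.
by apply: contra_neq x_neq0 => /Z_inj.
Qed.

Lemma quad_woodbury n p (S : 'M[R]_n) (V : 'M[R]_p) (C : 'M[R]_(p, n)) mu :
    S + C^T *m V *m C \in unitmx ->
  let H := S + C^T *m V *m C in
  let y := invmx H *m C^T *m V *m mu in
  quad (V - V *m C *m invmx H *m C^T *m V) mu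
    = quad V (mu - C *m y) + quad S y.
Proof.
move=> H_unit H y; have Hy : H *m y = C^T *m V *m mu.
  by rewrite /y !mulmxA mulmxV // mul1mx.
(* Since [S = H - C^T *m V *m C] and [y] solves [Hy], the term in [S] turns into terms in [V] only,
   which complete the square. *)
have ySy : y^T *m S *m y
    = y^T *m (C^T *m V *m mu) - y^T *m C^T *m V *m C *m y.
  by rewrite -Hy !mulmxDl !mulmxDr !mulmxA addrK.
suff: mu^T *m (V - V *m C *m invmx H *m C^T *m V) *m mu
    = (mu - C *m y)^T *m V *m (mu - C *m y) + y^T *m S *m y.
  by move=> eq_q; rewrite /quad eq_q mxE.
have ->: mu^T *m (V - V *m C *m invmx H *m C^T *m V) *m mu
    = mu^T *m V *m mu - mu^T *m V *m C *m y.
  by rewrite mulmxBr mulmxBl /y !mulmxA.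
rewrite ySy [(mu - _)^T]linearB /= trmx_mul !mulmxBl !mulmxBr !mulmxA.
by rewrite subrK.
Qed.

(* The matrix is (V^-1 + C S^-1 C^T)^-1, by the Woodbury identity. *)
Lemma spd_woodbury n p (S : 'M[R]_n) (V : 'M[R]_p) (C : 'M[R]_(p, n)) :
    spd S -> spd V ->
  spd (V - V *m C *m invmx (S + C^T *m V *m C) *m C^T *m V).
Proof.
move=> S_spd V_spd; have H_spd := spd_add_congr C S_spd V_spd.
have [[[trS S_gt0] [trV V_gt0]] [trH _]] := (S_spd, V_spd, H_spd).
split; first by rewrite linearB /= !trmx_mul trmxK trV trmx_inv trH !mulmxA.
move=> mu mu_neq0; rewrite quad_woodbury ?spd_unitmx //.
(* Strictness comes from [quad V mu] if [y] vanishes, and from [quad S y] otherwise. *)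
set y := _ *m mu; have [->|y_neq0] := eqVneq y 0.
  by rewrite mulmx0 subr0 quad0 addr0 V_gt0.
by rewrite ltr_wpDl ?S_gt0 ?spd_quad_ge0.
Qed.

(** Rank-nullity: the range has the full dimension [r] of the source, so the kernel is zero. *)
Lemma range_full_inj p r (Z : 'M[R]_(p, r)) :
  \dim (range Z) = r -> forall x : 'cV_r, Z *m x = 0 -> x = 0.
Proof.
move=> dimZ x Zx0; apply/eqP; rewrite -memv0.
suff /eqP <- : lker (linfun (mulmx Z : 'cV[R]_r -> 'cV[R]_p)) == 0%VS.
  by rewrite memv_ker lfunE /= Zx0.
have := limg_ker_dim (linfun (mulmx Z : 'cV[R]_r -> 'cV[R]_p)) fullv.
rewrite capfv -/(range Z) dimZ dimvf [dim _]muln1 => /eqP.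
by rewrite -[X in _ == X]add0n eqn_add2r dimv_eq0.
Qed.

End PositiveDefinite.

Section Interface.
Variables (R : realFieldType) (m : nat) (n_ : 'I_m -> nat).
Local Notation N := (\sum_(i < m) n_ i)%N.
Variable A : 'M[R]_N.

Lemma sum_Rank (P : pred 'I_N) (F : 'I_N -> R) :
  \sum_(k | P k) F k
    = \sum_i \sum_(a < n_ i | P (tagnat.Rank _ a)) F (tagnat.Rank _ a).
Proof.
rewrite (reindex (@tagnat.rank m n_)) ?[RHS]sig_big_dep /=.
  by apply: eq_big => -[i a].
exact/onW_bij/tagnat.rank_bij.
Qed.

(** Blocks that are not adjacent are zero, so the matrices [Dmx] of one subdomain add up to the row
    sums of [A] over all indices outside it. *)
Lemma AhatE (q s : 'I_N) : A^T = A ->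
  Ahat A q s = A q s *+ (tagnat.sig1 q == tagnat.sig1 s)
    - (\sum_(l | tagnat.sig1 l != tagnat.sig1 q) A q l) *+ (q == s).
Proof.
move=> trA; rewrite -(tagnat.sig2K q) -(tagnat.sig2K s).
move: (tagnat.sig1 q) (tagnat.sig2 q) (tagnat.sig1 s) (tagnat.sig2 s).
move=> i a j b; rewrite !tagnat.Rank1K.
have -> : Ahat A (tagnat.Rank _ a) (tagnat.Rank _ b)
    = submxblock (Ahat A) i j a b by rewrite [RHS]mxE.
rewrite -(inj_eq val_inj (tagnat.Rank _ a)) tagnat.eq_Rank.
have [eq_ij|neq_ij] := eqVneq i j; last first.
  by rewrite mxblockK /= (negPf neq_ij) mxE subrr.
case: _ / eq_ij b => b.
rewrite submxblock_diag !mxE /= mulr1n; congr (_ - _).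
rewrite summxE sum_Rank -sumrMnl big_mkcond [RHS]big_mkcond /=.
apply: eq_bigr => h _; rewrite /adj.
under [in RHS]eq_bigl do rewrite tagnat.Rank1K.
have [_|_] := eqVneq h i; first by rewrite big_pred0_eq mul0rn.
(* [adj h i] tests the block [(h, i)] while [Dmx A i h] sums the block [(i, h)]; symmetry of [A]
   carries the vanishing over. *)
case: eqVneq => [A_hi0|_] /=.
  rewrite big1 ?mul0rn // => l _.
  have /matrixP/(_ l a) := A_hi0; rewrite !mxE => <-.
  by rewrite -[in LHS]trA mxE.
rewrite !mxE; congr (_ *+ _).
by apply: eq_bigr => l _; rewrite !mxE mulr1.
Qed.

(** Pairs that are not edges contribute nothing: the indicator kills a wrong orientation, the factor
    [A k l] a zero entry. *)
Lemma sum_edges (F : 'I_N -> 'I_N -> R) :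
  \sum_(e < #|edges A|) A (edge e).1 (edge e).2 * F (edge e).1 (edge e).2
    = \sum_k \sum_l (A k l *+ (tagnat.sig1 k < tagnat.sig1 l)%N) * F k l.
Proof.
rewrite -(@big_enum_val _ _ _ _ (mem (edges A))
  (fun kl => A kl.1 kl.2 * F kl.1 kl.2)) /=.
rewrite pair_bigA big_mkcond; apply: eq_bigr => -[k l] _ /=.
rewrite inE /=; case: ltnP => _ /=; last by rewrite mul0r.
by case: eqVneq => //= ->; rewrite mul0r.
Qed.

Lemma sum_delta (k : 'I_N) (F : 'I_N -> R) : \sum_q (k == q)%:R * F q = F k.
Proof.
rewrite (bigD1 k) //= eqxx mul1r big1 ?addr0 // => q /negPf.
by rewrite eq_sym => ->; rewrite mul0r.
Qed.

Lemma Ahat_splitting : A^T = A ->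
  Ahat A = A + (2 *: Mmx A)^T *m (- Wmx A) *m (2 *: Mmx A).
Proof.
move=> trA; have symA k l : A k l = A l k by rewrite -[in LHS]trA mxE.
(* [u] keeps each coupling once, from the lower to the higher subdomain; its symmetrization [uD] is
   the part of [A] between distinct subdomains. *)
pose u k l := A k l *+ (tagnat.sig1 k < tagnat.sig1 l)%N.
have uD k l : u k l + u l k = A k l *+ (tagnat.sig1 l != tagnat.sig1 k).
  rewrite /u (symA l k) -mulrnDr -(inj_eq val_inj).
  by case: ltngtP.
apply/matrixP => q s; rewrite AhatE // mulmxN mulNmx.
rewrite [RHS]mxE [X in _ = _ + X]mxE.
have -> : ((2 *: Mmx A)^T *m Wmx A *m (2 *: Mmx A)) q s =
    \sum_k \sum_l u k l * (((q == k)%:R + (q == l)%:R)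
                            * ((s == k)%:R + (s == l)%:R)).
  rewrite -[RHS]sum_edges mxE; apply: eq_bigr => e _.
  rewrite mul_mx_diag !mxE !(mulrCA 2) !divff ?pnatr_eq0 // !mulr1.
  by rewrite mulrAC mulrC.
(* Of the four products of indicators, those that match [q] and [s] to the same endpoint yield the
   diagonal row sums; the two mixed ones yield [u q s] and [u s q]. *)
have -> : \sum_k \sum_l u k l * (((q == k)%:R + (q == l)%:R)
                            * ((s == k)%:R + (s == l)%:R))
  = \sum_k (q == k)%:R * ((s == k)%:R * \sum_l u k l)
    + \sum_k (q == k)%:R * (\sum_l (s == l)%:R * u k l)
    + \sum_k (s == k)%:R * (\sum_l (q == l)%:R * u k l)
    + \sum_k \sum_l (q == l)%:R * ((s == l)%:R * u k l).
  rewrite -!big_split /=; apply: eq_bigr => k _.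
  rewrite !mulr_sumr -!big_split /=; apply: eq_bigr => l _.
  rewrite !mulrA -!mulrDl -!mulrA [LHS]mulrC; congr (_ * _).
  rewrite mulrDl !mulrDr !addrA; congr (_ + _ + _); exact: mulrC.
rewrite [X in _ - (_ + X)]exchange_big /=.
under [X in _ - (_ + X)]eq_bigr => l _ do rewrite -!mulr_sumr.
rewrite !sum_delta.
have -> : \sum_(l | tagnat.sig1 l != tagnat.sig1 q) A q l
    = \sum_l u q l + \sum_l u l q.
  by rewrite -big_split big_mkcond; apply: eq_bigr => l _; rewrite /= uD mulrb.
have -> : A q s *+ (tagnat.sig1 q == tagnat.sig1 s)
    = A q s - (u q s + u s q).
  by rewrite uD eq_sym; case: eqVneq => _; rewrite ?subr0 ?subrr.
by rewrite -mulr_natl eq_sym; ring.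
Qed.

(** The sum of indicators in [Mmx] agrees with the disjunction in [Bmx] because the endpoints of an
    edge lie in different subdomains. The factor 4 is the ratio of 2 to 1/2. *)
Lemma Bmx_tr : Bmx A = 4 *: ((Mmx A)^T *m Wmx A).
Proof.
apply/matrixP => q e; rewrite mul_mx_diag !mxE.
have := enum_valP e; rewrite inE -/(edge e) => /andP[/ltn_eqF lt_e _].
have neq_e : (edge e).1 != (edge e).2.
  by apply: contraFneq lt_e => ->.
case: (eqVneq q (edge e).1) => [->|_] /=.
  by rewrite (negPf neq_e) /=; field.
by case: eqVneq => _ /=; field.
Qed.

End Interface.

Theorem corollary4p5 (R : realFieldType) (m : nat) (n_ : 'I_m -> nat)
    (A : 'M[R]_(\sum_(i < m) n_ i))
    (A_spd : spd A) (W_spd : spd (- Wmx A))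
    (r : nat) (Lambda : {vspace 'cV[R]_#|edges A|})
    (dim_Lambda : \dim Lambda = r)
    (Z : 'M[R]_(#|edges A|, r)) (range_Z : range Z = Lambda) :
  let W := Wmx A in
  let M := Mmx A in
  let B := Bmx A in
  let Ah := Ahat A in
  let Q : 'M[R]_(\sum_(i < m) n_ i + r) :=
    block_mx (4^-1 *: Ah)        (M^T *m W *m Z)
             (Z^T *m W *m M)     (- (Z^T *m W *m Z)) in
  let S_eta := schur Q in
  let S_lambda := - (W + 4 *: (W *m M *m invmx Ah *m M^T *m W)) in
  [/\ Ah \in unitmx /\ ulsubmx Q \in unitmx,
      spd S_eta,
      S_eta = Z^T *m S_lambda *m Z,
      S_lambda = - (W + W *m M *m invmx Ah *m B) &
      forall mu : 'cV[R]_#|edges A|,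
        mu \in Lambda -> mu != 0 -> 0 < quad S_lambda mu].
Proof.
move=> W M B Ah Q S_eta S_lambda.
have neq40 : (4 : R) != 0 by rewrite pnatr_eq0.
have AhE : Ah = A + (2 *: M)^T *m (- W) *m (2 *: M).
  by apply: Ahat_splitting; case: A_spd.
have Ah_unit : Ah \in unitmx.
  by rewrite AhE; apply/spd_unitmx/spd_add_congr.
have Q_unit : 4^-1 *: Ah \in unitmx.
  by rewrite unitmxZ // unitfE invr_neq0.
have S_lambda_spd : spd S_lambda.
  (* The Woodbury form with [V = - W] and [C = 2 *: M]: the two signs cancel and the two factors 2
     give the 4. *)
  have -> : S_lambda
      = - W - (- W) *m (2 *: M) *m invmx Ah *m (2 *: M)^T *m (- W).
    rewrite /S_lambda opprD; congr (_ - _).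
    rewrite mulmxN !mulNmx opprK [(2 *: M)^T]linearZ /=.
    by rewrite -!(scalemxAl, scalemxAr) scalerA -natrM.
  by rewrite AhE; apply: spd_woodbury.
(* Here the 4 arises from inverting the block [4^-1 *: Ah]. *)
have S_etaE : S_eta = Z^T *m S_lambda *m Z.
  rewrite /S_eta /schur block_mxKul block_mxKur block_mxKdl block_mxKdr.
  rewrite invmxZ // invrK /S_lambda mulmxN mulNmx mulmxDr mulmxDl opprD.
  by rewrite -!(scalemxAl, scalemxAr) !mulmxA.
have Z_inj : forall x : 'cV_r, Z *m x = 0 -> x = 0.
  by apply: range_full_inj; rewrite range_Z.
split=> //.
- by rewrite block_mxKul.
- by rewrite S_etaE; apply: spd_congr.
- by rewrite /S_lambda /B Bmx_tr -!scalemxAr !mulmxA.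
- by move=> mu _; case: S_lambda_spd => _; apply.
Qed.
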